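(* The set of $\mathcal{P}$-positions of $\mathcal{R}$-Wythoff equals the set of $\mathcal{P}$-positions of Wythoff's game, namely the set of positions $\{(\lfloor \phi n\rfloor, \lfloor \phi n\rfloor + n) : n \geq 0\}$ (positions being unordered), where $\phi = (1+\sqrt{5})/2$.
   Context: A position is an unordered pair $(a,b)$ of nonnegative integers (pile sizes); $(a,b)$ and $(b,a)$ are the same position. Two players alternate moves; the player making the last move wins. In Wythoff's game a move either removes a positive number of tokens from one pile, or removes the same positive number of tokens from both piles. $\mathcal{R}$-Wythoff is the restriction of Wythoff's game in which a move either removes a positive number of tokens from the larger pile (or from either pile if the two piles have equal size), or removes the same positive number of tokens from both piles; in particular, when the piles are unequal, removing tokens from only the smaller pile is not allowed. A $\mathcal{P}$-position is a position from which the player about to move has no winning strategy (equivalently, the positions of Sprague-Grundy value $0$). *)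

(* Defs.v *)
From mathcomp Require Import all_boot all_order all_algebra.
From mathcomp Require Import all_classical all_reals.

Set Implicit Arguments.
Unset Strict Implicit.
Unset Printing Implicit Defensive.

(* Unordered pairs of pile sizes, each represented by its sorted form;
   [piles a b] is the position with piles [a] and [b], in either order. *)
Definition position : Type := {p : nat * nat | p.1 <= p.2}.

Lemma piles_sorted (a b : nat) : (minn a b, maxn a b).1 <= (minn a b, maxn a b).2.
Proof. by rewrite /= geq_min leq_max leqnn. Qed.

Definition piles (a b : nat) : position :=
  exist _ (minn a b, maxn a b) (piles_sorted a b).

Lemma pilesC (a b : nat) : piles a b = piles b a.
Proof. by apply: val_inj; rewrite /= minnC maxnC. Qed.

Lemma piles_surj (p : position) : exists a b : nat, p = piles a b.
Proof.
case: p => -[a b] /= le_ab; exists a, b; apply: val_inj => /=.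
by rewrite (minn_idPl le_ab) (maxn_idPr le_ab).
Qed.

Lemma piles_eqP (a b c d : nat) :
  piles a b = piles c d <-> (a = c /\ b = d) \/ (a = d /\ b = c).
Proof.
split=> [/(congr1 val) /= [] | [[-> ->] | [-> ->]] //]; last exact: pilesC.
by case: (leqP a b) => _; case: (leqP c d) => _ -> ->; [left|right|right|left].
Qed.

(* Since [piles a b] = [piles b a], [b] stands for either of the two piles in
   [WythoffOne], and for a largest one in [RWythoffLarger]. *)
Inductive wythoff_move : position -> position -> Prop :=
| WythoffOne a b k of 0 < k <= b :
    wythoff_move (piles a b) (piles a (b - k))
| WythoffBoth a b k of 0 < k <= minn a b :
    wythoff_move (piles a b) (piles (a - k) (b - k)).

Inductive rwythoff_move : position -> position -> Prop :=
| RWythoffLarger a b k of a <= b & 0 < k <= b :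
    rwythoff_move (piles a b) (piles a (b - k))
| RWythoffBoth a b k of 0 < k <= minn a b :
    rwythoff_move (piles a b) (piles (a - k) (b - k)).

(* A derivation of [has_winning_strategy move p] is a winning strategy tree for
   the player about to move at [p]: a legal move, then a winning continuation
   against every reply of the opponent. An opponent without a legal reply has
   lost, as the last move wins. *)
Inductive has_winning_strategy (T : Type) (move : T -> T -> Prop) (p : T) : Prop :=
| WinningStrategy q of move p q &
    (forall r, move q r -> has_winning_strategy move r).

Definition P_positions (T : Type) (move : T -> T -> Prop) : set T :=
  [set p | ~ has_winning_strategy move p]%classic.

Definition golden_ratio (R : realType) : R := ((1 + Num.sqrt 5) / 2)%R.

(* Main.v *)
Require Import Defs.
From mathcomp Require Import all_boot all_order all_algebra.
From mathcomp Require Import all_classical all_reals.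
From mathcomp Require Import zify ring lra.

(** Write [A n] for the integer part of [phi * n]. The set [W] of the positions
  [(A n, A n + n)] is a kernel of both move graphs, and the terminating move
  relations have only one kernel, the set of P-positions. Every move of
  R-Wythoff is a move of Wythoff's game, so it is enough that no Wythoff move
  joins two elements of [W] and that an R-Wythoff move leads from every other
  position into [W]. Both follow from [A] being increasing and from the sequences
  [A n] and [A n + n] being complementary (Beatty's theorem for [phi] and
  [phi ^ 2 = phi + 1]). *)

Import Order.TTheory GRing.Theory Num.Theory.

Set Implicit Arguments.
Unset Strict Implicit.
Unset Printing Implicit Defensive.

(** * Kernels of terminating games *)

(** Inside [S] every strategy tree fails, by induction on it, as the opponent can always return to
    [S]; outside, moving into [S] at each turn wins, by induction on the decreasing [size]. *)
Lemma P_positions_kernel (T : Type) (move : T -> T -> Prop) (size : T -> nat)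
    (S : set T) :
  (forall p q, move p q -> size q < size p) ->
  (forall p q, move p q -> S p -> ~ S q) ->
  (forall p, ~ S p -> exists2 q, move p q & S q) ->
  P_positions move = S.
Proof.
move=> move_size S_stable S_absorbing.
have winN p : has_winning_strategy move p -> ~ S p.
  elim=> {}p q pq _ IH Sp.
  by have [r qr Sr] := S_absorbing q (S_stable _ _ pq Sp); apply: IH qr Sr.
have Nwin n p : size p < n -> ~ S p -> has_winning_strategy move p.
  elim: n p => // n IH p lt_pn NSp; have [q pq Sq] := S_absorbing p NSp.
  apply: (WinningStrategy pq) => r qr; apply: IH; last exact: S_stable qr Sq.
  by have := move_size _ _ pq; have := move_size _ _ qr; lia.
apply/seteqP; split=> p /= Pp; last by move/winN.
by apply: contrapT => NSp; apply: Pp; exact: Nwin (ltnSn _) NSp.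
Qed.

Lemma rwythoff_move_wythoff p q : rwythoff_move p q -> wythoff_move p q.
Proof. by case=> a b k => [_|] ?; [apply: WythoffOne | apply: WythoffBoth]. Qed.

Definition tokens (p : position) : nat := (val p).1 + (val p).2.

Lemma wythoff_move_tokens p q : wythoff_move p q -> tokens q < tokens p.
Proof. by case=> a b k; rewrite /tokens /=; lia. Qed.

(** * The kernel given by two complementary sequences *)

Section ComplementarySequence.
Variable A : nat -> nat.
Hypothesis A_mono : {homo A : m n / m < n}.
Hypothesis A_disj : forall m n, A n = A m + m -> m = 0.
Hypothesis A_cover : forall k, exists n, k = A n \/ k = A n + n.

Let W : set position := [set piles (A n) (A n + n) | n in [set: nat]]%classic.

Let A_inj m n : A m = A n -> m = n.
Proof. by case: (ltngtP m n) => // /A_mono; lia. Qed.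

Let A0 : A 0 = 0.
Proof. by have [n] := A_cover 0; case: (posnP n) => [->|/A_mono]; lia. Qed.

(** A one-pile move keeps a pile and a diagonal move keeps the difference of the piles; either one
    determines the index of an element of [W]. *)
Lemma wythoff_move_stable p q : wythoff_move p q -> W p -> ~ W q.
Proof.
have B_inj m n : A m + m = A n + n -> m = n.
  by case: (ltngtP m n) => // lt; have := A_mono lt; lia.
move=> pq [n _ np] [m _ mq]; case: pq np mq => a b k kP.
  move=> /piles_eqP np /piles_eqP mq.
  have [En|] : m = n \/ n = 0 /\ m = 0.
    case: np mq => -[na nb] [] [ma mb].
    - by left; apply: A_inj; lia.
    (* The kept pile [a] is [A n] before the move and [A m + m] after it; the sequences meet only at
       index 0. *)
    - right; have m0 : m = 0 by apply: (@A_disj m n); lia.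
      by subst m; split=> //; apply: A_inj; lia.
    - right; have n0 : n = 0 by apply: (@A_disj n m); lia.
      by subst n; split=> //; apply: A_inj; lia.
    - by left; apply: B_inj; lia.
  - by subst m; lia.
  - by case=> ? ?; subst m n; lia.
move=> /piles_eqP np /piles_eqP mq.
have En : m = n by lia.
by subst m; lia.
Qed.

(** The smaller pile is a term of one of the sequences. If the larger pile exceeds the partner of
    that term, it is cut down to it, a legal move in R-Wythoff; if it falls short, a diagonal move
    reaches [W]. *)
Lemma rwythoff_move_absorbing p : ~ W p -> exists2 q, rwythoff_move p q & W q.
Proof.
have [a [b ->]] := piles_surj p.
wlog le_ab : a b / a <= b.
  by move=> H; case: (leqP a b) => [/H //|/ltnW /H]; rewrite pilesC.
move: le_ab; have [n [->|->]] := A_cover a => le_ab NW.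
- case: (ltngtP b (A n + n)) => [lt_b|gt_b|Eb]; last first.
  + by case: NW; exists n; rewrite ?Eb.
  + exists (piles (A n) (A n + n)); last by exists n.
    have -> : A n + n = b - (b - (A n + n)) by lia.
    by apply: RWythoffLarger; lia.
  (* The diagonal move keeps the difference [b - A n]; being below [n], it indexes a pair with
     smaller piles. *)
  + have lt_dn : b - A n < n by lia.
    have lt_A := A_mono lt_dn.
    exists (piles (A (b - A n)) (A (b - A n) + (b - A n))); last by exists (b - A n).
    set d := b - A n in lt_dn lt_A *.
    have -> : piles (A d) (A d + d)
      = piles (A n - (A n - A d)) (b - (A n - A d)) by congr piles; lia.
    by apply: RWythoffBoth; lia.
- case: (ltngtP b (A n)) => [|gt_b|Eb]; first by lia.
  + exists (piles (A n + n) (A n)); last by exists n => //; rewrite pilesC.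
    have -> : piles (A n + n) (A n) = piles (A n + n) (b - (b - A n)).
      by congr piles; lia.
    by apply: RWythoffLarger; lia.
  + by case: NW; exists n => //; rewrite pilesC Eb.
Qed.

Lemma P_positions_wythoff : P_positions wythoff_move = W.
Proof.
apply: P_positions_kernel wythoff_move_tokens wythoff_move_stable _.
move=> p /rwythoff_move_absorbing [q pq Wq].
by exists q => //; exact: rwythoff_move_wythoff.
Qed.

Lemma P_positions_rwythoff : P_positions rwythoff_move = W.
Proof.
apply: (@P_positions_kernel _ _ tokens) rwythoff_move_absorbing.
- by move=> p q /rwythoff_move_wythoff /wythoff_move_tokens.
- by move=> p q /rwythoff_move_wythoff; exact: wythoff_move_stable.
Qed.

End ComplementarySequence.

(** * The lower Wythoff sequence *)

(* Infinite descent along [(k, n) |-> (n, k - n)]. *)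
Lemma golden_equation_nat k n : k * k = k * n + n * n -> n = 0.
Proof.
have [N] := ubnP n; elim: N k n => // N IH k n lt_nN E.
case: (posnP n) => // n_gt0.
have le_nk : n <= k by nia.
have Ek : n * n = n * (k - n) + (k - n) * (k - n) by nia.
have kn0 : k - n = 0 by apply: (IH n) => //; nia.
by nia.
Qed.

Section LowerWythoff.
Variable R : realType.
Local Open Scope ring_scope.
Local Notation phi := (golden_ratio R).
Local Notation A n := (Num.truncn (phi * n%:R)).

Lemma golden_ratio_sqr : phi * phi = phi + 1.
Proof.
have : Num.sqrt 5 * Num.sqrt 5 = 5 :> R by rewrite -expr2 sqr_sqrtr ?ler0n.
by rewrite /golden_ratio; lra.
Qed.

Lemma golden_ratio_gt1 : 1 < phi.
Proof.
have : Num.sqrt 5 * Num.sqrt 5 = 5 :> R by rewrite -expr2 sqr_sqrtr ?ler0n.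
by have := sqrtr_ge0 (5 : R); rewrite /golden_ratio; nra.
Qed.

Lemma golden_ratio_irrational k n : phi * n%:R = k%:R -> n = 0%N.
Proof.
move=> E; apply: (@golden_equation_nat k n); apply/eqP.
rewrite -(eqr_nat R) natrD !natrM -E; apply/eqP.
have -> : phi * n%:R * (phi * n%:R) = phi * phi * (n%:R * n%:R) by ring.
by rewrite golden_ratio_sqr; ring.
Qed.

Lemma lower_wythoff_itv n : (A n)%:R <= phi * n%:R < (A n)%:R + 1.
Proof.
have : 0 <= phi * n%:R by rewrite mulr_ge0 ?ler0n // ltW ?(lt_trans _ golden_ratio_gt1).
by move=> /truncn_itv; rewrite -natr1.
Qed.

Lemma lower_wythoff_eq k n : k%:R <= phi * n%:R < k%:R + 1 -> A n = k.
Proof. by move=> kn; apply: truncn_def; rewrite -natr1. Qed.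

Lemma lower_wythoff_mono : {homo (fun n => A n) : m n / (m < n)%N}.
Proof.
move=> m n lt_mn; have := lower_wythoff_itv m; have := lower_wythoff_itv n.
have : m%:R + 1 <= n%:R :> R by rewrite natr1 ler_nat.
have := golden_ratio_gt1 => ? ? /andP[? ?] /andP[? ?].
rewrite -(ltr_nat R); nra.
Qed.

(** For nonzero [m], irrationality gives [j < phi * m < j + 1] with [j = A m]. Multiplying by
    [phi - 1], the inverse of [phi], yields [phi * j < j + m] and [j + m + 1 < phi * (j + 1)], so no
    multiple of [phi] has integer part [j + m]. *)
Lemma lower_wythoff_disjoint m n : A n = (A m + m)%N -> m = 0%N.
Proof.
move=> E; have := lower_wythoff_itv n; have := lower_wythoff_itv m.
rewrite {}E natrD; set j := A m => /andP[jm mj] /andP[mn nm].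
have phi2 := golden_ratio_sqr; have phi1 := golden_ratio_gt1.
have [E|jm'] := eqVneq (phi * m%:R) j%:R; first exact: golden_ratio_irrational E.
have lt_jm : j%:R < phi * m%:R by rewrite lt_neqAle eq_sym jm' jm.
have phiV : (phi - 1) * (phi * m%:R) = m%:R by rewrite mulrA mulrBl phi2; ring.
have [|] := leqP n j; rewrite -(ler_nat R) -?natr1 => le_nj; exfalso.
- have : (phi - 1) * j%:R < m%:R by rewrite -[ltRHS]phiV ltr_pM2l //; lra.
  have : phi * n%:R <= phi * j%:R by rewrite ler_pM2l //; lra.
  by lra.
- have : m%:R < (phi - 1) * (j%:R + 1) by rewrite -[ltLHS]phiV ltr_pM2l //; lra.
  have : phi * (j%:R + 1) <= phi * n%:R by rewrite ler_pM2l //; lra.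
  by lra.
Qed.

Lemma lower_wythoff_cover k : exists n, k = A n \/ k = (A n + n)%N.
Proof.
have phi2 := golden_ratio_sqr; have phi1 := golden_ratio_gt1.
have phi_neq i j : (0 < j)%N -> phi * i%:R != j%:R.
  move=> j_gt0; apply/eqP => E; have i0 := golden_ratio_irrational E.
  by move: E; rewrite i0 mulr0 => /esym/eqP; rewrite pnatr_eq0 eqn0Ngt j_gt0.
(* The last index with [phi * m <= k + 1]; irrationality excludes equality. *)
pose m := Num.truncn (k.+1%:R / phi).
have /truncn_itv/andP[] : 0 <= k.+1%:R / phi by rewrite divr_ge0 //; lra.
rewrite -/m ler_pdivlMr ?ltr_pdivrMr; [|lra..].
rewrite ![_ * phi]mulrC => le_mk lt_km.
have lt_mk : phi * m%:R < k%:R + 1 by rewrite natr1 lt_neqAle phi_neq.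
have [le_km|gt_km] := lerP k%:R (phi * m%:R).
  by exists m; left; rewrite (@lower_wythoff_eq k) ?le_km.
have m_le_k : (m <= k)%N.
  by rewrite -(ler_nat R); have := ler0n R m; nra.
(* Here [phi * m < k] and [k + 1 < phi * (m + 1)]; multiplying both by [phi] and using
   [phi ^ 2 = phi + 1] gives [m < phi * (k - m) < m + 1]. *)
exists (k - m)%N; right; rewrite (@lower_wythoff_eq m) ?subnKC //.
move: lt_km; rewrite -!natr1 natrB // => lt_km.
have scale x y : x < y :> R -> phi * x < phi * y by rewrite ltr_pM2l //; lra.
have := scale _ _ gt_km; have := scale _ _ lt_km.
rewrite !(mulrA phi phi) phi2 => ? ?; by apply/andP; split; lra.
Qed.

End LowerWythoff.

Theorem theorem2p2 (R : realType) :
  P_positions rwythoff_move = P_positions wythoff_move /\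
  P_positions wythoff_move =
    [set piles (Num.truncn (golden_ratio R * n%:R)%R)
               (Num.truncn (golden_ratio R * n%:R)%R + n) | n in [set: nat]]%classic.
Proof.
have mono := @lower_wythoff_mono R; have disj := @lower_wythoff_disjoint R.
have cover := @lower_wythoff_cover R.
by rewrite (P_positions_rwythoff mono disj cover) (P_positions_wythoff mono disj cover).
Qed.
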